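(* Let $d\ge3$, let $W_1,\dots,W_d$ be complex vector spaces of dimensions $n_1,\dots,n_d\ge2$, and let $r_1,\dots,r_d$ be positive integers with $r_i\le n_i$ and $r_i\le\prod_{j\ne i}r_j$ for all $i=1,\dots,d$. Then the set of multilinear rank-$(r_1,\dots,r_d)$ complex tensors $$\{A\in W_1\otimes\cdots\otimes W_d:\mu\mathrm{rank}(A)=(r_1,\dots,r_d)\}$$ is path-connected.
   Context: All topological statements use the Euclidean topology. The multilinear rank of $A\in W_1\otimes\cdots\otimes W_d$ is the $d$-tuple $\mu\mathrm{rank}(A)=(r_1,\dots,r_d)$, where $r_i$ is the rank of the $i$th flattening of $A$, i.e. of $A$ viewed as a $2$-tensor (matrix) in $W_i\otimes\bigl(\bigotimes_{j\ne i}W_j\bigr)$; equivalently it is the minimal tuple $(r_1,\dots,r_d)$ such that $A\in U_1\otimes\cdots\otimes U_d$ for some subspaces $U_i\subseteq W_i$ with $\dim U_i=r_i$. *)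

(* Defs.v *)
From HB Require Import structures.
From mathcomp Require Import all_boot all_order all_algebra.
From mathcomp Require Import complex.
From mathcomp Require Import all_classical all_reals all_analysis.

Set Implicit Arguments.
Unset Strict Implicit.
Unset Printing Implicit Defensive.

Import Order.TTheory GRing.Theory Num.Theory.
Import numFieldNormedType.Exports.

Local Open Scope classical_set_scope.
Local Open Scope ring_scope.
Local Open Scope complex_scope.

(* Nonemptiness is part of the definition: the empty set is not regarded as
   path-connected. *)
Definition path_connected (R : realType) (T : topologicalType) (S : set T) :
    Prop :=
  S !=set0 /\
  forall x y : T, S x -> S y ->
  exists gamma : R -> T,
    [/\ {within `[0, 1], continuous gamma}, gamma 0 = x, gamma 1 = y &
        forall t : R, t \in `[0, 1] -> S (gamma t)].

Section Tensors.
Variables (R : realType) (I : finType).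
Implicit Types W : I -> vectType R[i].

Definition tensor_index W : finType := {dffun forall i, 'I_(\dim {: W i})}.

(* The tensor product of the family W, realised as the space of coordinate
   arrays relative to the bases vbasis {: W i}; tensor_universal below is its
   universal property. *)
Definition tensor W : Type := tensor_index W -> R[i]^o.

HB.instance Definition _ W :=
  GRing.Lmodule.copy (tensor W) (tensor_index W -> R[i]^o).

(* R[i]^o carries the topology of the complex modulus; on finitely many
   coordinates the product topology is the Euclidean one. *)
HB.instance Definition _ W :=
  Topological.copy (tensor W) (prod_topology (fun _ : tensor_index W => R[i]^o)).

Definition pure W (w : forall i, W i) : tensor W :=
  fun a => \prod_i coord (vbasis {: W i}) (a i) (w i).

Definition multilinear W (V : lmodType R[i]) (f : (forall i, W i) -> V) : Prop :=
  forall (w : forall i, W i) (i : I) (c : R[i]) (x y : W i),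
    f (eqtype.dfwith w (c *: x + y)) = c *: f (eqtype.dfwith w x) + f (eqtype.dfwith w y).

Lemma multilinear_sum W (V : lmodType R[i]) (f : (forall i, W i) -> V) w i n
    (c : 'I_n -> R[i]) (x : 'I_n -> W i) : multilinear f ->
  f (eqtype.dfwith w (\sum_k c k *: x k)) =
  \sum_k c k *: f (eqtype.dfwith w (x k)).
Proof.
move=> fM; elim: n c x => [|n IHn] c x.
  rewrite !big_ord0; have := fM w i (-1) 0 0.
  by rewrite scaler0 addr0 scaleN1r addNr.
by rewrite !big_ord_recl fM IHn.
Qed.

Lemma multilinear_ext W (V : lmodType R[i]) (f g : (forall i, W i) -> V) :
  multilinear f -> multilinear g ->
  (forall b : tensor_index W, f (fun i => (vbasis {: W i})`_(b i)) =
                              g (fun i => (vbasis {: W i})`_(b i))) ->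
  f =1 g.
Proof.
move=> fM gM fgb.
have ext (s : seq I) : forall w, (forall i, i \notin s ->
    exists k : 'I_(\dim {: W i}), w i = (vbasis {: W i})`_k) -> f w = g w.
  elim: s => [|i s IHs] w ws.
    pose b i := projT1 (cid (ws i isT)).
    have -> : w = fun i => (vbasis {: W i})`_((finfun b : tensor_index W) i).
      apply: functional_extensionality_dep => i; rewrite ffunE.
      exact: projT2 (cid (ws i isT)).
    exact: fgb.
  have wE : w = eqtype.dfwith w
      (\sum_k coord (vbasis {: W i}) k (w i) *: (vbasis {: W i})`_k).
    apply: functional_extensionality_dep => j.
    rewrite -coord_vbasis ?memvf//; have [<-|ij] := eqVneq i j.
      by rewrite eqtype.dfwith_in.
    by rewrite eqtype.dfwith_out.
  rewrite wE !multilinear_sum//; apply: eq_bigr => k _; congr (_ *: _).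
  apply: IHs => j js; have [<-|ij] := eqVneq i j.
    by exists k; rewrite eqtype.dfwith_in.
  by rewrite eqtype.dfwith_out//; apply: ws; rewrite inE negb_or eq_sym ij.
move=> w; apply: (ext (enum I)) => i; by rewrite mem_enum.
Qed.

Lemma pure_multilinear W : multilinear (@pure W).
Proof.
move=> w i c x y; apply: funext => a.
have pE (z : W i) : pure (eqtype.dfwith w z) a =
    coord (vbasis {: W i}) (a i) z *
    \prod_(j | j != i) coord (vbasis {: W j}) (a j) (w j).
  rewrite /pure (bigD1 i)//= eqtype.dfwith_in; congr (_ * _).
  by apply: eq_bigr => j ji; rewrite eqtype.dfwith_out// eq_sym.
by rewrite [RHS]/= /GRing.add/= /GRing.scale/= !pE linearP mulrDl -mulrA.
Qed.

Lemma pure_basis W (b a : tensor_index W) :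
  pure (fun i => (vbasis {: W i})`_(b i)) a = (a == b)%:R.
Proof.
rewrite /pure; have fr i : free (vbasis {: W i}) by exact: basis_free (vbasisP _).
under eq_bigr do rewrite coord_free//.
have [->|/eqP ab] := eqVneq a b; first by apply: big1 => i _; rewrite eqxx.
have [i abi] : exists i, a i != b i.
  apply/existsP; apply: contra_notT ab; rewrite negb_exists => /forallP ab.
  by apply/ffunP => i; apply/eqP; rewrite -[_ == _]negbK.
by rewrite (bigD1 i)//= eq_sym -val_eqE in abi *; rewrite (negbTE abi) mul0r.
Qed.

Lemma tensor_universal W (V : lmodType R[i]) (f : (forall i, W i) -> V) :
  multilinear f ->
  exists2 g : {linear tensor W -> V},
    forall w, g (pure w) = f w &
    forall h : {linear tensor W -> V}, (forall w, h (pure w) = f w) -> h =1 g.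
Proof.
move=> fM; pose e (b : tensor_index W) i := (vbasis {: W i})`_(b i).
pose g (A : tensor W) : V := \sum_b (A b : R[i]) *: f (e b).
have gL : linear g.
  move=> c A B; rewrite /g scaler_sumr -big_split; apply: eq_bigr => b _.
  by rewrite -[X in X *: _ = _]/(c * (A b : R[i]) + (B b : R[i])) scalerDl scalerA.
pose gg : {linear tensor W -> V} := HB.pack g (GRing.isLinear.Build _ _ _ _ g gL).
have ggf w : gg (pure w) = f w.
  move: w; apply: multilinear_ext => // [w i c x y|b].
    by rewrite pure_multilinear linearP.
  rewrite /= /g (bigD1 b)//= pure_basis eqxx scale1r big1 ?addr0// => a ab.
  by rewrite pure_basis (negbTE ab) scale0r.
exists gg => // h hf A.
have -> : A = \sum_b (A b : R[i]) *: pure (e b) :> tensor W.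
  apply: funext => a; rewrite fct_sumE (bigD1 a)//= big1 => [|b ba].
    by rewrite fctE pure_basis eqxx addr0 [_ *: _]mulr1.
  by rewrite fctE pure_basis eq_sym (negbTE ba) scaler0.
by rewrite !linear_sum; apply: eq_bigr => b _; rewrite !linearZ hf ggf.
Qed.

End Tensors.

Section Flattening.
Variables (R : realType) (I : finType) (W : I -> vectType R[i]) (i : I).

Definition other_factors (j : {j : I | j != i}) : vectType R[i] := W (val j).

Definition join_index (k : 'I_(\dim {: W i})) (b : tensor_index other_factors) :
    tensor_index W :=
  [ffun j => match eqVneq j i with
             | EqNotNeq e => ecast j' 'I_(\dim {: W j'}) (esym e) k
             | NeqNotEq ne => b (Sub j ne)
             end].

(* The i-th flattening: rows are coordinates in W i, columns are coordinates in
   the tensor product of the other factors; see flattening_pure. *)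
Definition flattening (A : tensor W) :
    'M[R[i]]_(\dim {: W i}, #|tensor_index other_factors|) :=
  \matrix_(k, l) A (join_index k (enum_val l)).

Definition flattening_rank (A : tensor W) : nat := \rank (flattening A).

Lemma join_index_in k b : join_index k b i = k.
Proof.
by rewrite ffunE; case: eqVneq => [e|/negP//]; rewrite (eq_irrelevance e erefl).
Qed.

Lemma join_index_out k b (j : {j | j != i}) : join_index k b (val j) = b j.
Proof.
case: j => j jP; rewrite ffunE /=; case: eqVneq => [e|ne].
  by exfalso; move/eqP: jP; apply.
by rewrite (bool_irrelevance ne jP).
Qed.

Lemma flattening_linear : linear flattening.
Proof. by move=> c A B; apply/matrixP => k l; rewrite !mxE. Qed.

Lemma flattening_pure (w : forall j, W j) k l :
  flattening (pure w) k l =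
  coord (vbasis {: W i}) k (w i) *
  pure (fun j => w (val j) : other_factors j) (enum_val l).
Proof.
rewrite mxE; set b := enum_val l.
rewrite /pure (bigD1 i)//= join_index_in; congr (_ * _).
rewrite (big_sub (fun j => j != i)
  (fun j => coord (vbasis {: W j}) (join_index k b j) (w j))).
by apply: eq_bigr => j _; rewrite join_index_out.
Qed.

End Flattening.

Definition multilinear_rank (R : realType) (d : nat) (W : 'I_d -> vectType R[i])
    (A : tensor W) : {ffun 'I_d -> nat} :=
  [ffun i => flattening_rank i A].

(* Main.v *)
(* A tensor of multilinear rank at most r is a multilinear product (G_i) . T of
   n_i x r_i matrices with an r_1 x ... x r_d core T, and conversely. So join A
   and B by the complex line through parameters (G, S) and (H, T): along it the
   rank is at most r everywhere, and at least r away from the zeros of a nonzero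
   polynomial in the line's parameter z, because this already holds at z = 0.
   Some arc from 0 to 1 in the complex plane avoids the finitely many zeros.

   For nonemptiness, the bound r_i <= prod_{j != i} r_j gives for each i a
   tensor supported in the box r_1 x ... x r_d whose i-th flattening has rank
   r_i; a generic combination of these has all the required ranks. *)

Require Import Defs.
From HB Require Import structures.
From mathcomp Require Import all_boot all_order all_algebra.
From mathcomp Require Import complex.
From mathcomp Require Import all_classical all_reals all_analysis.

Set Implicit Arguments.
Unset Strict Implicit.
Unset Printing Implicit Defensive.

Import Order.TTheory GRing.Theory Num.Theory.
Import numFieldNormedType.Exports.

Local Open Scope classical_set_scope.
Local Open Scope ring_scope.
Local Open Scope complex_scope.

(** * Sums over dependent finite functions *)

(** Dependent functions are encoded as functions into the tagged sum of the [T_ i], where the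
    non-dependent distributive law applies. *)
Lemma big_distr_dffun (K : comPzRingType) (I : finType) (T_ : I -> finType)
    (F : forall i, T_ i -> K) :
  \prod_i \sum_(x : T_ i) F i x =
  \sum_(f : {dffun forall i, T_ i}) \prod_i F i (f i).
Proof.
have distr := @big_fprod K 0 1 *%R +%R I T_ (fun i => [ffun x => F i x]).
rewrite (reindex (@dffun_of_fprod I T_)); last first.
  exact/onW_bij/dffun_of_fprod_bij.
under [RHS]eq_bigr do under eq_bigr do rewrite ffunE.
transitivity
  (\sum_(t : fprod T_) \prod_(i in I) [ffun x => F i x] (t i)); last first.
  by apply: eq_bigr => t _; apply: eq_bigr => i _; rewrite ffunE.
rewrite distr.
transitivity (\prod_i \sum_(j in tagged_with T_ i) untag 0 [ffun x => F i x] j).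
  apply: eq_bigr => i _.
  rewrite -(big_tag (fun i => [ffun x => F i x])).
  by apply: eq_bigr => x _; rewrite ffunE.
exact: bigA_distr_big_dep.
Qed.

Lemma dffun_neq (I : finType) (T_ : I -> finType)
    (a b : {dffun forall i, T_ i}) : a != b -> exists i, a i != b i.
Proof.
move=> ab; apply/existsP; move: ab; apply: contraR.
rewrite negb_exists => /forallP ab.
by apply/eqP/ffunP => i; apply/eqP/negbNE/ab.
Qed.

(** * Rank factorizations and ranks of polynomial matrices *)

Section RankFactorization.
Variable F : fieldType.

(** [G *m H] is the projector onto the column space of [M]: a column basis times a left inverse of
    it. The partial identities only pad the inner dimension from the rank up to [k]. *)
Lemma rank_le_factor m n k (M : 'M[F]_(m, n)) : (\rank M <= k)%N ->
  exists (G : 'M[F]_(m, k)) (H : 'M[F]_(k, m)), G *m H *m M = M.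
Proof.
move=> rk; exists (col_base M *m pid_mx (\rank M)).
exists (pid_mx (\rank M) *m pinvmx (col_base M)).
rewrite mulmxA -(mulmxA (col_base M)) pid_mx_id// pid_mx_1 mulmx1.
have CM : pinvmx (col_base M) *m M = row_base M.
  by rewrite -[X in _ *m X]mulmx_base mulmxA mulVpmx ?col_base_full// mul1mx.
by rewrite -mulmxA CM mulmx_base.
Qed.

(** One-sided inverses [X], [Y] of the bases of [M0] compress [M0] to an identity matrix of size its
    rank. The determinant of the same compression of [M] is a polynomial with value 1 at [z0]; where
    it does not vanish, the rank is at least that size. *)
Lemma rank_horner_generic m n (M : 'M[{poly F}]_(m, n)) z0 :
  exists2 p : {poly F}, p != 0 & forall z, p.[z] != 0 ->
    (\rank (map_mx (horner_eval z0) M) <= \rank (map_mx (horner_eval z) M))%N.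
Proof.
set M0 := map_mx _ M.
pose X := pinvmx (col_base M0); pose Y := pinvmx (row_base M0).
have XMY : X *m M0 *m Y = 1%:M.
  rewrite -[X in _ *m X *m _]mulmx_base mulmxA mulVpmx ?col_base_full// mul1mx.
  by rewrite mulmxVp ?row_base_free.
pose p := \det (map_mx polyC X *m M *m map_mx polyC Y).
have map_polyCK z a b (N : 'M[F]_(a, b)) :
    map_mx (horner_eval z) (map_mx polyC N) = N.
  by apply/matrixP => i j; rewrite !mxE /horner_eval hornerC.
have pE z : p.[z] = \det (X *m map_mx (horner_eval z) M *m Y).
  by rewrite -[LHS]/(horner_eval z p) -det_map_mx !map_mxM !map_polyCK.
exists p => [|z].
  apply/eqP => /(congr1 (fun q => q.[z0])); rewrite pE XMY det1 horner0.
  by move/eqP; rewrite oner_eq0.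
rewrite pE -unitfE -/(_ \in unitmx) => /mxrank_unit <-.
exact: leq_trans (mxrankM_maxl _ _) (mxrankM_maxr _ _).
Qed.

End RankFactorization.

(** * Multilinear products of matrices with a core *)

Section MultilinearMultiplication.
Variables (K : comPzRingType) (I : finType).

(** Each [G i] acts on its own mode of [T]. Scalars from any commutative ring allow polynomial
    entries, later evaluated through [rmorph_mlmul]. *)
Definition mlmul (m n : I -> nat) (G : forall i, 'M[K]_(n i, m i))
    (T : {dffun forall i, 'I_(m i)} -> K) : {dffun forall i, 'I_(n i)} -> K :=
  fun a => \sum_(b : {dffun forall i, 'I_(m i)})
    (\prod_i G i (a i) (b i)) * T b.

Lemma mlmul_mlmul (l m n : I -> nat) (G : forall i, 'M[K]_(n i, m i))
    (H : forall i, 'M[K]_(m i, l i)) T :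
  mlmul G (mlmul H T) = mlmul (fun i => G i *m H i) T.
Proof.
apply: funext => a; rewrite /mlmul.
under eq_bigr do rewrite mulr_sumr.
rewrite exchange_big; apply: eq_bigr => c _.
under [in RHS]eq_bigr do rewrite mxE.
rewrite big_distr_dffun mulr_suml; apply: eq_bigr => b _.
by rewrite mulrA -big_split.
Qed.

Lemma mlmul1 (n : I -> nat) (T : {dffun forall i, 'I_(n i)} -> K) :
  mlmul (fun=> 1%:M) T = T.
Proof.
apply: funext => a; rewrite /mlmul (bigD1 a)//= big1 => [|i _]; last first.
  by rewrite mxE eqxx.
rewrite mul1r big1 ?addr0// => b ba.
have [i bai] := @dffun_neq I (fun i => 'I_(n i)) _ _ ba.
by rewrite (bigD1 i)//= mxE eq_sym (negbTE bai) !mul0r.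
Qed.

End MultilinearMultiplication.

Lemma rmorph_mlmul (K L : comPzRingType) (f : {rmorphism K -> L}) (I : finType)
    (m n : I -> nat) (G : forall i, 'M[K]_(n i, m i)) T a :
  f (mlmul G T a) = mlmul (fun i => map_mx f (G i)) (fun b => f (T b)) a.
Proof.
rewrite rmorph_sum; apply: eq_bigr => b _; rewrite rmorphM rmorph_prod.
by congr (_ * _); apply: eq_bigr => i _; rewrite mxE.
Qed.

(** * Flattening ranks and multilinear products *)

Section FlatteningRank.
Variables (R : realType) (I : finType) (W : I -> vectType R[i]).
Local Notation C := R[i].
Implicit Types (A : tensor W) (i : I).

Definition drop_index i (a : tensor_index W) :
    tensor_index (@other_factors R I W i) :=
  [ffun j => a (val j)].
Arguments drop_index : clear implicits.

Lemma join_drop_index i (a : tensor_index W) :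
  join_index (a i) (drop_index i a) = a.
Proof.
apply/ffunP => j; have [->|ji] := eqVneq j i; first by rewrite join_index_in.
by rewrite (join_index_out (a i) (drop_index i a) (Sub j ji)) ffunE.
Qed.

Lemma flatteningE i A (a : tensor_index W) :
  A a = flattening i A (a i) (enum_rank (drop_index i a)).
Proof. by rewrite mxE enum_rankK join_drop_index. Qed.

(** The flattening factors as [G i *m H] with inner dimension [m i], where [H] flattens the product
    of [T] with the matrices of the other modes. *)
Lemma mlmul_flattening_rank (m : I -> nat)
    (G : forall i, 'M[C]_(\dim {: W i}, m i)) T i :
  (flattening_rank i (mlmul G T : tensor W) <= m i)%N.
Proof.
pose rest := tensor_index (@other_factors R I W i).
pose H : 'M[C]_(m i, #|rest|) := \matrix_(c, l)
  \sum_(b : {dffun forall i, 'I_(m i)} | b i == c)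
    (\prod_(j : {j | j != i}) G (val j) ((enum_val l : rest) j) (b (val j)))
    * T b.
suff -> : flattening_rank i (mlmul G T : tensor W) = \rank (G i *m H).
  exact: leq_trans (mxrankM_maxl _ _) (rank_leq_col _).
congr (\rank _); apply/matrixP => k l; rewrite !mxE /mlmul.
rewrite (partition_big (fun b : {dffun forall i, 'I_(m i)} => b i) xpredT)//=.
apply: eq_bigr => c _; rewrite mxE mulr_sumr; apply: eq_bigr => b /eqP <-.
rewrite (bigD1 i)//= join_index_in mulrA; congr (_ * _ * _).
rewrite (big_sub (fun j => j != i)
  (fun j => G j (join_index k (enum_val l) j) (b j))).
by apply: eq_bigr => j _; rewrite join_index_out.
Qed.

Lemma mode_product_id i (P : forall j, 'M[C]_(\dim {: W j})) A :
  P i *m flattening i A = flattening i A ->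
  mlmul (fun j => if j == i then P j else 1%:M) A = A.
Proof.
move=> PA; apply: funext => a.
rewrite [RHS](flatteningE i) -PA mxE /mlmul.
rewrite (partition_big (fun b : tensor_index W => b i) xpredT)//=.
apply: eq_bigr => k _; rewrite mxE enum_rankK.
set c := join_index k _.
have ci : c i = k by rewrite join_index_in.
have cE j : j != i -> c j = a j.
  by move=> ji; rewrite (join_index_out k (drop_index i a) (Sub j ji)) ffunE.
(* Outside mode [i] the factors are entries of identity matrices, so among the [b] with [b i = k]
   only [c] contributes. *)
rewrite (bigD1 c) ?ci//= (bigD1 i)//= eqxx ci big1 ?mulr1; last first.
  by move=> j ji; rewrite (negbTE ji) cE// mxE eqxx.
rewrite big1 ?addr0// => b /andP[/eqP bi bc].
have [j jb] := dffun_neq bc.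
have ji : j != i by apply: contraNneq jb => ->; rewrite bi ci.
rewrite (bigD1 j)//= (negbTE ji) -cE// mxE eq_sym (negbTE jb).
by rewrite !mul0r.
Qed.

(** The modes are treated one at a time; uniqueness of the list ensures that each [P i] is applied
    only once. *)
Lemma mlmul_id (P : forall j, 'M[C]_(\dim {: W j})) A :
  (forall i, P i *m flattening i A = flattening i A) -> mlmul P A = A.
Proof.
move=> PA.
have ext (s : seq I) : uniq s ->
    mlmul (fun j => if j \in s then P j else 1%:M) A = A.
  elim: s => [_|i s IHs /= /andP[iNs us]]; first exact: mlmul1.
  rewrite -[RHS](mode_product_id (PA i)) -[in RHS](IHs us) mlmul_mlmul.
  congr (mlmul _ A); apply: functional_extensionality_dep => j; rewrite inE.
  have [->|ji] := eqVneq j i; first by rewrite (negbTE iNs) mulmx1.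
  by rewrite mul1mx.
rewrite -[RHS](ext (enum I)) ?enum_uniq//; congr (mlmul _ A).
by apply: functional_extensionality_dep => j; rewrite mem_enum.
Qed.

(** Each [G i *m H i] fixes the [i]-th flattening, so [H] applied to [A] is a core from which [G]
    recovers [A]. *)
Lemma mlmul_surj (m : I -> nat) A :
  (forall i, (flattening_rank i A <= m i)%N) ->
  exists (G : forall i, 'M[C]_(\dim {: W i}, m i)) T, A = mlmul G T.
Proof.
move=> rA.
pose fact i := rank_le_factor (rA i).
pose G i := sval (cid (fact i)).
pose H i := sval (cid (svalP (cid (fact i)))).
exists G, (mlmul H A); rewrite mlmul_mlmul mlmul_id// => i.
exact: svalP (cid (svalP (cid (fact i)))).
Qed.

End FlatteningRank.

(** * Continuity of polynomials and coordinatewise convergence *)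

Lemma horner_continuous (K : numFieldType) (p : {poly K}) :
  continuous (horner p : K^o -> K^o).
Proof.
move=> x; elim/poly_ind: p => [|p c IHp].
  have -> : horner 0 = cst 0 :> (K -> K) by apply: funext => z; rewrite horner0.
  exact: cst_continuous.
have -> : horner (p * 'X + c%:P) = (fun z => p.[z] * z + c) :> (K -> K).
  by apply: funext => z; rewrite hornerMXaddC.
apply: (@continuousD K K K (fun z => p.[z] * z) (cst c)).
  by apply: (@continuousM K K (horner p) id) => //; exact: cvg_id.
exact: cst_continuous.
Qed.

Lemma real_complex_continuous (R : realType) :
  continuous (real_complex R : R -> R[i]^o).
Proof.
(* A positive complex number has zero imaginary part, so the estimate reduces to a real one. *)
move=> x; apply/cvgrPdist_lt => e; rewrite ltcE/= => /andP[/eqP e0 Re0].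
near=> t.
rewrite -rmorphB/= normc_def/= expr0n addr0 sqrtr_sqr ltcE/= e0 eqxx/=.
by near: t; exact: cvgr_dist_lt.
Unshelve. all: by end_near.
Qed.

Lemma cvg_tensor (R : realType) (I : finType) (W : I -> vectType R[i])
    (T : Type) (F : set_system T) (f : T -> tensor W) (l : tensor W) :
  Filter F ->
  (forall a, f t a @[t --> F] --> (l a : R[i]^o)) -> f t @[t --> F] --> l.
Proof.
move=> FF H; apply/cvg_sup => a U [_ [[V oV <-] Vl] VU].
apply: (filterS VU); apply: H; exact: open_nbhs_nbhs.
Qed.

(** * Parabolic arcs in the complex plane avoiding finitely many points *)

Section Paths.
Variable R : realType.
Local Notation C := R[i].

Definition arc (s t : R) : C := t +i* (s * (t * (1 - t))).

Lemma arc0 s : arc s 0 = 0. Proof. by rewrite /arc mul0r mulr0. Qed.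

Lemma arc1 s : arc s 1 = 1. Proof. by rewrite /arc subrr !mulr0. Qed.

(** Writing the arc as a polynomial in the real parameter lets continuity along it follow from
    continuity of polynomials. *)
Definition arc_poly s : {poly C} := 'X + (0 +i* s)%:P * ('X * (1 - 'X)).

Lemma arc_polyE s t : (arc_poly s).[t%:C] = arc s t.
Proof.
rewrite !hornerE/= /arc; apply/eqP; rewrite eq_complex/=.
by rewrite !(mul0r, mulr0, oppr0, add0r, addr0) -mulrA !eqxx.
Qed.

(* The arcs with distinct parameters meet only at 0 and 1, so each root lies on
   at most one of them. *)
Lemma arc_avoids_roots (p : {poly C}) : p != 0 ->
  exists s, forall t, 0 < t < 1 -> p.[arc s t] != 0.
Proof.
move=> p0; apply: contrapT => /forallNP H.
have {}H (k : 'I_(size p)) : exists t, 0 < t < 1 /\ root p (arc k%:R t).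
  have /existsNP[t /not_implyP[t01 /negP]] := H k%:R.
  by rewrite negbK => pt; exists t.
pose tt k := sval (cid (H k)).
have ttP k : 0 < tt k < 1 /\ root p (arc k%:R (tt k)) := svalP (cid (H k)).
pose rs := [seq arc (k%:R : R) (tt k) | k : 'I_(size p)].
suff: (size rs < size p)%N by rewrite size_map size_enum_ord ltnn.
apply: max_poly_roots => //.
  by apply/allP => _ /mapP[k _ ->]; have [] := ttP k.
rewrite map_inj_uniq ?enum_uniq// => j k [] tjk.
have [/andP[t0 t1] _] := ttP k.
rewrite tjk => /mulIf; rewrite mulf_neq0 ?gt_eqF ?subr_gt0// => /(_ isT) /eqP.
by rewrite eqr_nat => /eqP /val_inj.
Qed.

Lemma exists_nonroot (p : {poly C}) : p != 0 -> exists z, p.[z] != 0.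
Proof.
case/arc_avoids_roots => s ps; exists (arc s 2^-1); apply: ps.
by rewrite invr_gt0 ltr0n invf_lt1 ?ltr0n// ltr1n.
Qed.

End Paths.

(** * Polynomial families of tensors *)

Section TensorPencils.
Variables (R : realType) (I : finType) (W : I -> vectType R[i]).
Local Notation C := R[i].
Implicit Types P : tensor_index W -> {poly C}.

Definition tensor_horner P z : tensor W := fun a => (P a).[z].

(** The point [z] may differ from mode to mode: each mode yields its own nonzero polynomial, and
    their product serves all modes at once. *)
Lemma tensor_horner_rank_generic (m : I -> nat) P :
  (forall i, exists z, (m i <= flattening_rank i (tensor_horner P z))%N) ->
  exists2 p : {poly C}, p != 0 & forall z, p.[z] != 0 ->
    forall i, (m i <= flattening_rank i (tensor_horner P z))%N.
Proof.
move=> H.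
have {}H i : exists p : {poly C}, p != 0 /\ forall z, p.[z] != 0 ->
    (m i <= flattening_rank i (tensor_horner P z))%N.
  have [z0 mz0] := H i.
  pose rest := tensor_index (@other_factors R I W i).
  pose M : 'M[{poly C}]_(\dim {: W i}, #|rest|) := \matrix_(k, l)
    P (join_index (i := i) k (enum_val l)).
  have [p p0 pz] := rank_horner_generic M z0.
  have ME z : flattening i (tensor_horner P z) = map_mx (horner_eval z) M.
    by apply/matrixP => k l; rewrite !mxE.
  exists p; split=> // z /pz; rewrite -!ME; exact: leq_trans.
pose q i := sval (cid (H i)).
exists (\prod_i q i) => [|z].
  by apply/prodf_neq0 => i _; have [] := svalP (cid (H i)).
rewrite horner_prod => /prodf_neq0 qz i.
by have [_] := svalP (cid (H i)); apply; exact: qz.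
Qed.

Lemma tensor_horner_continuous P s :
  continuous (fun t : R => tensor_horner P (arc s t)).
Proof.
move=> x; apply: cvg_tensor => a.
have PE t : tensor_horner P (arc s t) a =
    (P a \Po arc_poly s).[real_complex R t].
  by rewrite horner_comp arc_polyE.
rewrite PE; under eq_fun do rewrite PE.
apply: (@continuous_comp R C^o C^o); first exact: real_complex_continuous.
exact: horner_continuous.
Qed.

Lemma tensor_horner_path (r : I -> nat) P :
  (forall i z, (flattening_rank i (tensor_horner P z) <= r i)%N) ->
  (forall i, flattening_rank i (tensor_horner P 0) = r i) ->
  (forall i, flattening_rank i (tensor_horner P 1) = r i) ->
  exists gamma : R -> tensor W,
    [/\ {within `[0, 1], continuous gamma}, gamma 0 = tensor_horner P 0,
        gamma 1 = tensor_horner P 1 &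
        forall t : R, t \in `[0, 1] ->
          forall i, flattening_rank i (gamma t) = r i].
Proof.
move=> rP r0 r1.
have [|p p0 pr] := @tensor_horner_rank_generic r P.
  by move=> i; exists 0; rewrite r0.
have [s ps] := arc_avoids_roots p0.
exists (fun t => tensor_horner P (arc s t)); split.
- exact/continuous_subspaceT/tensor_horner_continuous.
- by rewrite arc0.
- by rewrite arc1.
(* The arc is known to avoid the roots only for [0 < t < 1]; at the endpoints the ranks are
   given. *)
move=> t; rewrite in_itv/= !le_eqVlt => /andP[/predU1P[<-|t0]].
  by rewrite arc0.
move=> /predU1P[->|t1] i; first by rewrite arc1.
apply/eqP; rewrite eqn_leq rP pr//; apply: ps; exact/andP.
Qed.

End TensorPencils.

(** * Existence of tensors with the prescribed multilinear rank *)

Lemma mxrank_mxsub (F : fieldType) m n p q (f : 'I_p -> 'I_m) (g : 'I_q -> 'I_n)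
    (A : 'M[F]_(m, n)) : (\rank (mxsub f g A) <= \rank A)%N.
Proof.
have rowsub_rank a b c (h : 'I_a -> 'I_b) (B : 'M[F]_(b, c)) :
    (\rank (rowsub h B) <= \rank B)%N by exact/mxrankS/rowsub_sub.
rewrite [mxsub f g A](_ : _ = rowsub f (colsub g A)); last first.
  by apply/matrixP => i j; rewrite !mxE.
apply: leq_trans (rowsub_rank _ _ _ _ _) _.
by rewrite -mxrank_tr trmx_mxsub -[leqRHS]mxrank_tr rowsub_rank.
Qed.

Section Nonempty.
Variables (R : realType) (I : finType) (W : I -> vectType R[i]).
Variable r : I -> nat.
Local Notation C := R[i].
Hypothesis r_le_dim : forall i, (r i <= \dim {: W i})%N.
Hypothesis r_le_prod : forall i, (r i <= \prod_(j | j != i) r j)%N.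

Definition box_supported (A : tensor W) :=
  forall a, A a != 0 -> forall i, (a i < r i)%N.

(** Rows of index at least [r i] vanish, so a partial identity of rank [r i] fixes the
    flattening. *)
Lemma box_supported_rank A i :
  box_supported A -> (flattening_rank i A <= r i)%N.
Proof.
move=> Abox; rewrite /flattening_rank.
have -> : flattening i A =
    (pid_mx (r i) : 'M[C]_(\dim {: W i})) *m flattening i A.
  apply/matrixP => k l; rewrite [RHS]mxE (bigD1 k)//= big1 ?addr0 => [|k' kk'].
    rewrite [pid_mx _ _ _]mxE eqxx/= [RHS]mulrC.
    case: ltnP => [_|kr]; rewrite ?mulr1//.
    rewrite mulr0 mxE; apply/eqP; apply: contraTT kr => /Abox/(_ i).
    by rewrite join_index_in -ltnNge.
  by rewrite mxE val_eqE eq_sym (negbTE kk') mul0r.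
by apply: leq_trans (mxrankM_maxl _ _) _; rewrite rank_pid_mx.
Qed.

Lemma card_box_other i :
  #|{dffun forall j : {j | j != i}, 'I_(r (val j))}| = \prod_(j | j != i) r j.
Proof.
rewrite card_dep_ffun foldrE big_image/= (big_sub (fun j => j != i) r).
by apply: eq_bigr => j _; rewrite card_ord.
Qed.

(** The box has at least [r i] columns in the flattening. Ones placed in row [k] and the [k]-th such
    column, for [k < r i], form an identity submatrix. *)
Lemma box_supported_flattening_rank_ge i :
  exists2 A : tensor W, box_supported A & (r i <= flattening_rank i A)%N.
Proof.
pose B : finType := {dffun forall j : {j | j != i}, 'I_(r (val j))}.
have rB : (r i <= #|B|)%N by rewrite card_box_other.
pose e (b : B) : tensor_index (@other_factors R I W i) :=
  [ffun j => widen_ord (r_le_dim (val j)) (b j)].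
have e_inj : injective e.
  move=> b b' ebb'; apply/ffunP => j; apply/val_inj.
  by have /ffunP/(_ j) := ebb'; rewrite !ffunE => /(congr1 val).
pose f (k : 'I_(r i)) := e (enum_val (widen_ord rB k)).
have f_inj : injective f.
  move=> k k' /e_inj/enum_val_inj/(congr1 val) /= kk'; exact: val_inj.
pose w k := widen_ord (r_le_dim i) k.
pose A : tensor W := fun a => [exists k, a == join_index (w k) (f k)]%:R.
exists A => [a|].
  rewrite /A pnatr_eq0 eqb0 negbK => /existsP[k /eqP->] j.
  have [->|ji] := eqVneq j i; first by rewrite join_index_in/=.
  by rewrite (join_index_out _ _ (Sub j ji)) ffunE/=.
suff fA : mxsub w (fun k => enum_rank (f k)) (flattening i A) = 1%:M.
  by rewrite -[X in (X <= _)%N](mxrank1 C) -fA mxrank_mxsub.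
apply/matrixP => k l; rewrite !mxE enum_rankK /A; congr (_ %:R).
congr nat_of_bool.
apply/existsP/eqP => [[k' /eqP /ffunP E]|->]; last by exists l.
have kk' : k = k'.
  have := E i; rewrite !join_index_in => /(congr1 val)/= ?; exact: val_inj.
apply: f_inj; apply/ffunP => j; have := E (val j); rewrite !join_index_out.
by rewrite kk' => ->.
Qed.

(** Induction on the list of modes: on the line from [A] to [B], a generic point keeps the bounds
    reached at [A] and gains that of the new mode from [B], without leaving the box. *)
Lemma exists_multilinear_rank :
  exists A : tensor W, forall i, flattening_rank i A = r i.
Proof.
have ext (s : seq I) : exists2 A, box_supported A &
    forall i, i \in s -> (r i <= flattening_rank i A)%N.
  elim: s => [|i s [A Abox As]].
    by exists (fun=> 0) => // a; rewrite eqxx.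
  have [B Bbox Bi] := box_supported_flattening_rank_ge i.
  pose P (a : tensor_index W) : {poly C} := (A a)%:P + 'X * (B a - A a)%:P.
  have P0 : tensor_horner P 0 = A.
    by apply: funext => a; rewrite /tensor_horner !hornerE.
  have P1 : tensor_horner P 1 = B.
    apply: funext => a; rewrite /tensor_horner hornerD hornerM !hornerC hornerX.
    by rewrite mul1r addrC subrK.
  (* The value 0 imposes no condition on modes not yet treated. *)
  pose m j := if j \in i :: s then r j else 0%N.
  have [j|p /exists_nonroot[z pz] /(_ z pz) Pm] :=
    @tensor_horner_rank_generic _ _ _ m P.
    rewrite /m inE; case: eqVneq => [->|_] /=; first by exists 1; rewrite P1.
    by exists 0; rewrite P0; case: ifP => // /As.
  exists (tensor_horner P z) => [a|j js]; last by have := Pm j; rewrite /m js.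
  have [Aa0|/Abox//] := eqVneq (A a) 0; have [Ba0|/Bbox//] := eqVneq (B a) 0.
  by rewrite /tensor_horner !hornerE Aa0 Ba0 subrr mulr0 addr0 eqxx.
have [A Abox Ar] := ext (enum I).
exists A => i; apply/eqP; rewrite eqn_leq box_supported_rank//.
by rewrite Ar ?mem_enum.
Qed.

End Nonempty.

(** * Joining two tensors of equal multilinear rank *)

Theorem theorem8p3 (R : realType) (d : nat) (hd : (3 <= d)%N)
    (W : 'I_d -> vectType R[i]) (n : 'I_d -> nat)
    (hW : forall i, \dim {: W i} = n i) (hn : forall i, (2 <= n i)%N)
    (r : {ffun 'I_d -> nat}) (hr0 : forall i, (0 < r i)%N)
    (hrn : forall i, (r i <= n i)%N)
    (hr : forall i, (r i <= \prod_(j < d | j != i) r j)%N) :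
  path_connected R [set A : tensor W | multilinear_rank A = r].
Proof.
have rankP (A : tensor W) :
    multilinear_rank A = r <-> forall i, flattening_rank i A = r i.
  split=> [/ffunP rA i|rA]; first by rewrite -rA ffunE.
  by apply/ffunP => i; rewrite ffunE.
split=> [|A B /= /rankP rA /rankP rB].
  have [|//|A rA] := @exists_multilinear_rank R _ W r.
    by move=> i; rewrite hW.
  by exists A; apply/rankP.
have [i|G [S defA]] := @mlmul_surj _ _ _ r A; first by rewrite rA.
have [i|H [T defB]] := @mlmul_surj _ _ _ r B; first by rewrite rB.
(* The parameter line from [(G, S)] to [(H, T)], with the polynomial variable as its parameter; it
   gives [A] at 0 and [B] at 1. *)
pose P := mlmul
  (fun i => map_mx polyC (G i) + 'X *: map_mx polyC (H i - G i))
  (fun b => (S b)%:P + 'X * (T b - S b)%:P).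
have PE z : tensor_horner P z =
    mlmul (fun i => G i + z *: (H i - G i)) (fun b => S b + z * (T b - S b)).
  apply: funext => a; rewrite -[LHS]/(horner_eval z _) rmorph_mlmul.
  congr (mlmul _ _ a).
    apply: functional_extensionality_dep => i; apply/matrixP => j k.
    by rewrite !mxE /= /horner_eval !hornerE.
  apply: functional_extensionality_dep => b.
  by rewrite /= /horner_eval !hornerE.
have P0 : tensor_horner P 0 = A.
  rewrite PE defA; congr (mlmul _ _).
    by apply: functional_extensionality_dep => i; rewrite scale0r addr0.
  by apply: functional_extensionality_dep => b; rewrite mul0r addr0.
have P1 : tensor_horner P 1 = B.
  rewrite PE defB; congr (mlmul _ _).
    by apply: functional_extensionality_dep => i; rewrite scale1r addrC subrK.
  by apply: functional_extensionality_dep => b; rewrite mul1r addrC subrK.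
have [i z|||gamma [gc g0 g1 gr]] := @tensor_horner_path _ _ _ r P.
(* The inner dimensions [r i] bound the ranks along the whole line. *)
- by rewrite PE mlmul_flattening_rank.
- by rewrite P0.
- by rewrite P1.
exists gamma; split; rewrite ?g0 ?g1 ?P0 ?P1// => t t01.
exact/rankP/gr.
Qed.
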